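(* If $\alpha\in\mathbb{D}^{\mathbb{Z}}$ is a Gordon sequence, then the extended CMV matrix $\mathcal{E}_\alpha$ has purely continuous spectrum (that is, it has no eigenvalues).
   Context: $\mathbb{D} = \{z \in \mathbb{C} : |z|<1\}$ and $\alpha(n)=\alpha_n$. Given $\alpha = (\alpha_n)_{n\in\mathbb{Z}}$ with $\alpha_n \in \mathbb{D}$ (the Verblunsky coefficients), the corresponding extended CMV matrix is the unitary operator $\mathcal{E}_\alpha = \mathcal{L}\mathcal{M}$ on $\ell^2(\mathbb{Z})$, where $$\mathcal{L} = \bigoplus_{j\in\mathbb{Z}} \Theta(\alpha_{2j}),\quad \mathcal{M} = \bigoplus_{j\in\mathbb{Z}} \Theta(\alpha_{2j+1}),\quad \Theta(\alpha) = \begin{pmatrix} \overline{\alpha} & \rho \\ \rho & -\alpha\end{pmatrix},\quad \rho = \sqrt{1-|\alpha|^2},$$ and $\Theta(\alpha_n)$ acts on $\ell^2(\{n,n+1\})$. A sequence $\alpha\in\mathbb{D}^{\mathbb{Z}}$ is a Gordon sequence if it is bounded away from $\partial\mathbb{D}$ (i.e. $\|\alpha\|_\infty<1$) and there exist positive integers $n_k\to\infty$ such that, for either choice of sign, $$\lim_{k\to\infty} C^{n_k}\max_{0\le j\le n_k-1}|\alpha(j)-\alpha(j\pm n_k)| = 0\quad\text{for all } C>0.$$ *)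

(* Defs.v *)
From HB Require Import structures.
From mathcomp Require Import all_boot all_order all_algebra.
From mathcomp Require Import complex.
From mathcomp Require Import all_classical all_reals all_analysis.
From mathcomp Require Import ring lra zify.

Set Implicit Arguments.
Unset Strict Implicit.
Unset Printing Implicit Defensive.

Import Order.TTheory GRing.Theory Num.Theory.
Import numFieldNormedType.Exports.
Local Open Scope classical_set_scope.
Local Open Scope ring_scope.
Local Open Scope complex_scope.

(* The modulus of z : R[i] as an element of R; the generic `|z| lives in R[i]. *)
Notation normc := Normc.normc.

Section SummableInt.
Variable R : realType.
Implicit Types f g : int -> R.
Let sumb f := summable [set: int] (fun n => (f n)%:E).

Lemma summable_le f g : (forall n, 0 <= f n) -> (forall n, f n <= g n) ->
  sumb g -> sumb f.
Proof.
move=> f0 fg; apply: le_lt_trans; apply: le_esum => n _ /=.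
by rewrite lee_fin !ger0_norm// (le_trans (f0 n)).
Qed.

Lemma summable_addr f g : sumb f -> sumb g -> sumb (fun n => f n + g n).
Proof. exact: summableD. Qed.

Lemma summable_muln f k : sumb f -> sumb (fun n => f n *+ k).
Proof.
move=> sf; elim: k => [|k IH].
  rewrite /sumb/= /summable esum1 ?ltry// => n _.
  by rewrite mulr0n abse0.
rewrite (_ : (fun n => _) = (fun n => f n + f n *+ k)).
  exact: summable_addr.
by apply/funext => n; rewrite mulrS.
Qed.

Lemma summable_shift f k : sumb f -> sumb (fun n => f (n + k)).
Proof.
rewrite /sumb /summable.
rewrite (@reindex_esum R int int [set: int] [set: int] (fun n => n + k))//.
split=> // [x y _ _ /addIr//|y _ /=].
by exists (y - k) => //; rewrite subrK.
Qed.

End SummableInt.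

Section ell2.
Variable R : realType.
Local Notation C := (R[i]).

Definition square_summable : {pred int -> C^o} :=
  [pred psi : int -> C^o |
    `[< summable [set: int] (fun n => (normc (psi n) ^+ 2)%:E) >]].

Lemma square_summableP (psi : int -> C^o) :
  reflect (summable [set: int] (fun n => (normc (psi n) ^+ 2)%:E))
          (psi \in square_summable).
Proof. exact: asboolP. Qed.

Lemma normc_ge0 (x : C) : 0 <= normc x.
Proof. by case: x => a b; exact: sqrtr_ge0. Qed.

Lemma sqr_normcD (x y : C) :
  normc (x + y) ^+ 2 <= (normc x ^+ 2 + normc y ^+ 2) *+ 2.
Proof.
have := le_normcD x y; have := normc_ge0 (x + y).
have := normc_ge0 x; have := normc_ge0 y.
move: (normc x) (normc y) (normc (x + y)) => a b c b0 a0 c0 cab.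
apply: (@le_trans _ _ ((a + b) ^+ 2)); first by rewrite ler_sqr// nnegrE addr_ge0.
have := sqr_ge0 (a - b); rewrite sqrrB sqrrD mulr2n.
move: (a ^+ 2) (b ^+ 2) (a * b *+ 2) => p q r; lra.
Qed.

Lemma square_summable_submod_closed : submod_closed square_summable.
Proof.
split=> [|a u v].
  apply/square_summableP; rewrite /summable esum1 ?ltry// => n _.
  by rewrite Normc.normc0 expr0n abse0.
move=> /square_summableP su /square_summableP sv; apply/square_summableP.
apply: (@summable_le R _ (fun n =>
  (normc (u n) ^+ 2 *+ (Num.bound (normc a ^+ 2)) + normc (v n) ^+ 2) *+ 2)).
- by move=> n; exact: sqr_ge0.
- move=> n; rewrite -[(a *: u + v) n]/(a * u n + v n).
  apply: le_trans (sqr_normcD _ _) _.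
  rewrite lerMn2r/= lerD2r Normc.normcM exprMn -mulr_natl.
  rewrite ler_wpM2r ?sqr_ge0// ltW// (le_lt_trans (ler_norm _))//.
  by rewrite ger0_norm ?sqr_ge0 ?archi_boundP ?sqr_ge0.
- by apply: summable_muln; apply: summable_addr => //; apply: summable_muln.
Qed.

HB.instance Definition _ :=
  GRing.isSubmodClosed.Build C (int -> C^o) square_summable
    square_summable_submod_closed.

Record ell2 := Ell2 {
  ell2_val :> int -> C^o;
  ell2_valP : ell2_val \in square_summable }.

HB.instance Definition _ := [isSub for ell2_val].
HB.instance Definition _ := [Choice of ell2 by <:].
HB.instance Definition _ := [SubChoice_isSubLmodule of ell2 by <:].

(* The direct sum over j of the T j, with T j acting on the coordinates
   {2 j + s, 2 j + s + 1}: coordinate n belongs to block j = (n - s) %/ 2, at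
   position i = (n - s) %% 2 (in intdiv the remainder is 0 or 1 also for
   negative n - s). *)
Definition dsum2_fun (s : int) (T : int -> 'M[C]_2) (psi : int -> C^o) :
    int -> C^o := fun n =>
  let j := ((n - s) %/ 2)%Z in
  let i : 'I_2 := inord `|((n - s) %% 2)%Z|%N in
  \sum_(k < 2) T j i k * psi (2 * j + s + k%:Z).

Lemma dsum2_linear s T : linear (dsum2_fun s T).
Proof.
move=> a u v; apply/funext => n.
rewrite -[RHS]/(a * dsum2_fun s T u n + dsum2_fun s T v n) /dsum2_fun.
set j := (_ %/ _)%Z; set i := inord _.
rewrite !big_ord_recl !big_ord0.
pose E m : (a *: u + v) m = a * u m + v m := erefl.
by rewrite !E; ring.
Qed.

Lemma dsum2_square_summable (s : int) (T : int -> 'M[C]_2) (psi : int -> C^o) :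
  (forall j i k, normc (T j i k) <= 1) ->
  psi \in square_summable -> dsum2_fun s T psi \in square_summable.
Proof.
move=> T1 /square_summableP spsi; apply/square_summableP.
pose f n := normc (psi n) ^+ 2.
apply: (@summable_le R _ (fun n => (f n + (f (n + 1) + f (n + (-1)))) *+ 2)).
- by move=> n; exact: sqr_ge0.
- move=> n; rewrite /dsum2_fun; set j := (_ %/ _)%Z; set i := inord _.
  rewrite big_ord_recl big_ord1 /=; apply: le_trans (sqr_normcD _ _) _.
  rewrite lerMn2r/= !Normc.normcM !exprMn.
  apply: (@le_trans _ _ (f (2 * j + s + 0) + f (2 * j + s + 1))).
    by apply: lerD; rewrite ler_piMl ?sqr_ge0// expr_le1// normc_ge0.
  have f0 m : 0 <= f m by exact: sqr_ge0.
  have [->|->] : 2 * j + s = n \/ 2 * j + s = n - 1 by rewrite /j; lia.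
    by rewrite addr0; have := f0 (n + (-1)); lra.
  by rewrite addr0 subrK; have := f0 (n + 1); lra.
- apply: summable_muln; apply: summable_addr => //.
  by apply: summable_addr; exact: (@summable_shift R f).
Qed.

End ell2.

Section cmv.
Variable R : realType.
Local Notation C := (R[i]).

Record disk := Disk { disk_val :> C; disk_valP : normc disk_val < 1 }.

Definition Theta (a : C) : 'M[C]_2 :=
  let rho := (Num.sqrt (1 - normc a ^+ 2))%:C in
  \matrix_(i, j) if i == j then (if i == 0 then conjc a else - a) else rho.

Lemma Theta_le1 (a : disk) i j : normc (Theta a i j) <= 1.
Proof.
have := disk_valP a; case: a => -[x y] /= _ xy1; rewrite mxE.
case: ifP => _; first by case: ifP => _ /=; rewrite ?sqrrN ltW.
rewrite /= expr0n addr0 sqrtr_sqr ger0_norm ?sqrtr_ge0//.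
by rewrite -[leRHS]sqrtr1 ler_wsqrtr// gerBl sqr_ge0.
Qed.

Definition Theta_sum (alpha : int -> disk) (s : int) (psi : ell2 R) : ell2 R :=
  Ell2 (@dsum2_square_summable R s (fun j => Theta (alpha (2 * j + s))) psi
          (fun j => Theta_le1 _) (ell2_valP psi)).

Lemma Theta_sum_is_linear alpha s : linear (Theta_sum alpha s).
Proof.
move=> a u v; apply: val_inj; exact: dsum2_linear.
Qed.

HB.instance Definition _ alpha s :=
  GRing.isLinear.Build C (ell2 R) (ell2 R) _ (Theta_sum alpha s)
    (Theta_sum_is_linear alpha s).

Definition CMV_L (alpha : int -> disk) : {linear ell2 R -> ell2 R} :=
  Theta_sum alpha 0.
Definition CMV_M (alpha : int -> disk) : {linear ell2 R -> ell2 R} :=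
  Theta_sum alpha 1.
Definition extended_CMV (alpha : int -> disk) : {linear ell2 R -> ell2 R} :=
  CMV_L alpha \o CMV_M alpha.

Definition Gordon_sequence (alpha : int -> disk) : Prop :=
  (ereal_sup (range (fun n => (normc (alpha n))%:E)) < 1)%E /\
  exists N : nat -> nat,
    [/\ forall k, (0 < N k)%N,
        N @ \oo --> \oo &
        forall e : int, (e = 1 \/ e = -1) -> forall c : R, 0 < c ->
          (fun k => c ^+ N k *
             \big[Num.max/0]_(j < N k)
                normc ((alpha j%:Z : C) - (alpha (j%:Z + e * (N k)%:Z) : C)))
            @ \oo --> (0 : R)].

Definition is_eigenvalue (T : {linear ell2 R -> ell2 R}) (z : C) : Prop :=
  exists psi : ell2 R, psi != 0 /\ T psi = z *: psi.

Definition purely_continuous_spectrum (T : {linear ell2 R -> ell2 R}) : Prop :=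
  forall z : C, ~ is_eigenvalue T z.

End cmv.

(* Main.v *)
(* An eigenvector u of E = L M with eigenvalue z <> 0 yields, together with
   v = M u, a two-component solution of a first-order recursion with the Szego
   matrices rho^-1 [[w^-1, -alpha_n], [-conj alpha_n, w]], w^2 = z, which have
   determinant one. Gordon's argument compares the solution at 0 with its values
   at N, 2 N and -N, where N = n_k is an approximate period: Cayley-Hamilton
   bounds |X 0| by |X N| + |X (2 N)| + |X (-N)| up to an error of size
   C^N max |alpha_j - alpha_(j +- N)|. Square summability sends the right-hand
   side to 0, so the solution vanishes. The case z = 0 is excluded because each
   Theta block is invertible. *)
Require Import Defs.
From mathcomp Require Import all_boot all_order all_algebra.
From mathcomp Require Import complex.
From mathcomp Require Import all_classical all_reals all_analysis.
From mathcomp Require Import ring lra zify.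

Set Implicit Arguments.
Unset Strict Implicit.
Unset Printing Implicit Defensive.

Import Order.TTheory GRing.Theory Num.Theory.
Import numFieldNormedType.Exports.
Local Open Scope classical_set_scope.
Local Open Scope ring_scope.
Local Open Scope complex_scope.

(** * Entry-sum norm, 2 x 2 adjugates and the three-block inequality *)

Section EntrySumNorm.
Variable R : realType.
Local Notation C := (R[i]).

Lemma normc_opp (x : C) : normc (- x) = normc x.
Proof. by case: x => a b /=; rewrite !sqrrN. Qed.

Lemma normc_conj (x : C) : normc x^* = normc x.
Proof. by case: x => a b /=; rewrite sqrrN. Qed.

Lemma normc_real (x : R) : 0 <= x -> normc x%:C = x.
Proof. by move=> x0; rewrite /= expr0n addr0 sqrtr_sqr ger0_norm. Qed.

Lemma conjMc (x : C) : x^* * x = (normc x ^+ 2)%:C.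
Proof.
case: x => a b /=; rewrite sqr_sqrtr ?addr_ge0 ?sqr_ge0//.
by apply/eqP; rewrite eq_complex /=; apply/andP; split; apply/eqP; ring.
Qed.

(** The entry sum is submultiplicative for all shapes, so a single norm serves both the one-step
    matrices and the column vectors they act on. *)
Definition sumnorm m n (A : 'M[C]_(m, n)) : R := \sum_i \sum_j normc (A i j).

Lemma sumnorm_ge0 m n (A : 'M[C]_(m, n)) : 0 <= sumnorm A.
Proof. by do 2!apply: sumr_ge0 => ? _; exact: normc_ge0. Qed.

Lemma sumnorm0 m n : sumnorm (0 : 'M[C]_(m, n)) = 0.
Proof. by do 2!apply: big1 => ? _; rewrite mxE Normc.normc0. Qed.

Lemma sumnorm_eq0 m n (A : 'M[C]_(m, n)) : sumnorm A = 0 -> A = 0.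
Proof.
move=> /eqP; rewrite psumr_eq0 => [/allP A0|i _]; last first.
  by apply: sumr_ge0 => ? _; exact: normc_ge0.
apply/matrixP => i j; rewrite mxE; apply: Normc.eq0_normc.
have := A0 i (mem_index_enum i); rewrite psumr_eq0 => [/allP Ai0|k _]; last first.
  exact: normc_ge0.
exact/eqP/(Ai0 j (mem_index_enum j)).
Qed.

Lemma sumnormN m n (A : 'M[C]_(m, n)) : sumnorm (- A) = sumnorm A.
Proof. by do 2!apply: eq_bigr => ? _; rewrite mxE normc_opp. Qed.

Lemma sumnormD m n (A B : 'M[C]_(m, n)) : sumnorm (A + B) <= sumnorm A + sumnorm B.
Proof.
rewrite /sumnorm -big_split; apply: ler_sum => i _ /=.
by rewrite -big_split; apply: ler_sum => j _; rewrite mxE le_normcD.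
Qed.

Lemma sumnormB m n (A B : 'M[C]_(m, n)) : sumnorm (A - B) <= sumnorm A + sumnorm B.
Proof. by rewrite -[sumnorm B]sumnormN sumnormD. Qed.

Lemma sumnormBC m n (A B : 'M[C]_(m, n)) : sumnorm (A - B) = sumnorm (B - A).
Proof. by rewrite -sumnormN opprB. Qed.

Lemma sumnormZ m n a (A : 'M[C]_(m, n)) : sumnorm (a *: A) = normc a * sumnorm A.
Proof.
rewrite /sumnorm mulr_sumr; apply: eq_bigr => i _; rewrite mulr_sumr.
by apply: eq_bigr => j _; rewrite mxE Normc.normcM.
Qed.

Lemma normc_sum (I : finType) (F : I -> C) : normc (\sum_i F i) <= \sum_i normc (F i).
Proof.
elim/big_ind2: _ => [|x1 x2 y1 y2 h1 h2|//]; first by rewrite Normc.normc0.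
exact: le_trans (le_normcD _ _) (lerD h1 h2).
Qed.

Lemma sumnormM m n p (A : 'M[C]_(m, n)) (B : 'M[C]_(n, p)) :
  sumnorm (A *m B) <= sumnorm A * sumnorm B.
Proof.
rewrite [leRHS]mulr_suml; apply: ler_sum => i _.
apply: (@le_trans _ _ (\sum_k \sum_j normc (A i j) * normc (B j k))).
  apply: ler_sum => k _; rewrite mxE; apply: le_trans (normc_sum _) _.
  by apply: ler_sum => j _; rewrite Normc.normcM.
rewrite exchange_big mulr_suml; apply: ler_sum => j _.
rewrite -mulr_sumr ler_wpM2l ?normc_ge0//.
rewrite /sumnorm (bigD1 j) //= lerDl.
by do 2!apply: sumr_ge0 => ? _; exact: normc_ge0.
Qed.

Lemma sum_ord2 (V : nmodType) (F : 'I_2 -> V) : \sum_i F i = F 0 + F 1.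
Proof. by rewrite big_ord_recl big_ord1; congr (_ + F _); apply: val_inj. Qed.

Lemma ord2_ind (P : 'I_2 -> Prop) : P 0 -> P 1 -> forall i, P i.
Proof.
by move=> P0 P1 [[|[|//]] i2]; [move: P0 | move: P1]; congr (P _); apply: val_inj.
Qed.

Lemma sumnorm2 (A : 'M[C]_2) :
  sumnorm A = normc (A 0 0) + normc (A 0 1) + (normc (A 1 0) + normc (A 1 1)).
Proof. by rewrite /sumnorm !sum_ord2. Qed.

Lemma sumnorm_col2 (x : 'cV[C]_2) : sumnorm x = normc (x 0 0) + normc (x 1 0).
Proof. by rewrite /sumnorm sum_ord2 !big_ord1. Qed.

(* The adjugate of a 2 x 2 matrix, written so that it is visibly linear. *)
Definition adj2 (A : 'M[C]_2) : 'M[C]_2 := (\tr A)%:M - A.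

Lemma adj2B A B : adj2 (A - B) = adj2 A - adj2 B.
Proof. by rewrite /adj2 linearB /= raddfB /= !opprD addrACA. Qed.

(** The adjugate swaps the two diagonal entries and negates the other two. *)
Lemma sumnorm_adj2 A : sumnorm (adj2 A) = sumnorm A.
Proof.
rewrite !sumnorm2 /adj2 /mxtrace sum_ord2 !mxE /= !mulr1n !mulr0n !sub0r !normc_opp.
by rewrite [A 0 0 + _ - _]addrAC subrr add0r addrK; ring.
Qed.

Lemma det2 (A : 'M[C]_2) : \det A = A 0 0 * A 1 1 - A 0 1 * A 1 0.
Proof.
have l0 : lift (0 : 'I_2) (0 : 'I_1) = 1 by exact: val_inj.
have l1 : lift (1 : 'I_2) (0 : 'I_1) = 0 by exact: val_inj.
rewrite (expand_det_row _ 0) sum_ord2 /cofactor !det_mx11 !mxE l0 l1.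
by rewrite expr0 expr1 mulN1r mul1r mulrN.
Qed.

Lemma mul_adj2 A : \det A = 1 -> adj2 A *m A = 1%:M.
Proof.
rewrite det2 => detA; apply/matrixP => i j.
rewrite !mxE sum_ord2 /adj2 /mxtrace sum_ord2 !mxE -detA.
elim/ord2_ind: i; elim/ord2_ind: j; rewrite /= ?mulr1n ?mulr0n; ring.
Qed.

(* Gordon's three-block argument: adj2 B is B^-1, and by Cayley-Hamilton
   B + B^-1 = tr B; if |tr B| <= 1 apply this to B x, otherwise to x. *)
Lemma gordon_three_block (B B1 B2 : 'M[C]_2) (x y : 'cV[C]_2) :
  \det B = 1 -> \det B2 = 1 -> B2 *m y = x ->
  sumnorm x <= sumnorm (B *m x) + sumnorm (B1 *m (B *m x)) + sumnorm y
    + (sumnorm (B1 - B) * sumnorm (B *m x) + sumnorm (B2 - B) * sumnorm x).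
Proof.
move=> detB detB2 B2y.
(* [B2] carries [y] to [x], so its adjugate carries [x] back to [y]; by linearity of [adj2],
   replacing [B2] by [B] costs only the adjugate of the difference. *)
have invx : adj2 B *m x = y - adj2 (B2 - B) *m x.
  have <- : adj2 B2 *m x = y by rewrite -B2y mulmxA mul_adj2// mul1mx.
  by rewrite adj2B (mulmxBl (adj2 B2)) opprB addrC subrK.
have CH : \tr B *: x = B *m x + adj2 B *m x.
  by rewrite /adj2 mulmxBl addrC subrK mul_scalar_mx.
(* Cayley-Hamilton at [B x], with the outer factor [B] replaced by [B1]. *)
have CH2 : x = \tr B *: (B *m x) - B1 *m (B *m x) + (B1 - B) *m (B *m x).
  rewrite mulmxBl -addrA addKr -mul_scalar_mx -mulmxBl mulmxA.
  by rewrite -/(adj2 B) mul_adj2// mul1mx.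
have := sumnorm_ge0 (B1 *m (B *m x)); have := sumnorm_ge0 y.
have p1 : 0 <= sumnorm (B1 - B) * sumnorm (B *m x) by rewrite mulr_ge0 ?sumnorm_ge0.
have p2 : 0 <= sumnorm (B2 - B) * sumnorm x by rewrite mulr_ge0 ?sumnorm_ge0.
have [tr1|tr1] := leP (normc (\tr B)) 1.
  have := sumnormD (\tr B *: (B *m x) - B1 *m (B *m x)) ((B1 - B) *m (B *m x)).
  rewrite -CH2; have := sumnormB (\tr B *: (B *m x)) (B1 *m (B *m x)).
  have := sumnormM (B1 - B) (B *m x); rewrite sumnormZ.
  have : normc (\tr B) * sumnorm (B *m x) <= sumnorm (B *m x).
    by rewrite ler_piMl ?sumnorm_ge0.
  lra.
have := sumnormD (B *m x) (adj2 B *m x); rewrite -CH invx sumnormZ.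
have := sumnormB y (adj2 (B2 - B) *m x).
have := sumnormM (adj2 (B2 - B)) x; rewrite sumnorm_adj2.
have : sumnorm x <= normc (\tr B) * sumnorm x by rewrite ler_peMl ?sumnorm_ge0 1?ltW.
lra.
Qed.

End EntrySumNorm.

(** * Transfer matrices and Gordon's argument for determinant-one recursions *)

Section Transfer.
Variables (R : realType) (A : int -> 'M[R[i]]_2).
Local Notation C := (R[i]).

Fixpoint transfer (m : int) (n : nat) : 'M[C]_2 :=
  if n is n'.+1 then A (m + n'%:Z) *m transfer m n' else 1%:M.

Lemma det_transfer m n : (forall j, \det (A j) = 1) -> \det (transfer m n) = 1.
Proof.
by move=> detA; elim: n => [|n IH] /=; rewrite ?det1// det_mulmx detA IH mulr1.
Qed.

Lemma transferP (X : int -> 'cV[C]_2) m n :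
  (forall j, X (j + 1) = A j *m X j) -> transfer m n *m X m = X (m + n%:Z).
Proof.
move=> XA; elim: n => [|n IH] /=; first by rewrite mul1mx addr0.
by rewrite -mulmxA IH -XA -addrA -[in RHS]addn1 PoszD.
Qed.

Variable K : R.
Hypothesis AK : forall j, sumnorm (A j) <= K.

(** The factor 2 is the entry sum of the 2 x 2 identity. The base [K + 2] is chosen so that the
    induction in [transfer_diff] closes exactly. *)
Lemma transfer_bound m n : sumnorm (transfer m n) <= 2 * (K + 2) ^+ n.
Proof.
have K0 : 0 <= K by rewrite (le_trans (sumnorm_ge0 _) (AK 0)).
elim: n => [|n IH] /=.
  rewrite expr0 sumnorm2 !mxE /= ?mulr1n ?mulr0n /= !expr1n !expr0n /=.
  rewrite !addr0 sqrtr1 sqrtr0; lra.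
apply: le_trans (sumnormM _ _) _; rewrite exprS mulrCA.
apply: ler_pM; rewrite ?sumnorm_ge0//.
by apply: le_trans (AK _) _; rewrite lerDl.
Qed.

(** The last factor telescopes: A T - A' T' = (A - A') T + A' (T - T'). By [transfer_bound] the
    first term contributes 2 and, by induction, the second contributes K to the new factor
    [K + 2]. *)
Lemma transfer_diff m m' n e :
  0 <= e ->
  (forall j, (j < n)%N -> sumnorm (A (m + j%:Z) - A (m' + j%:Z)) <= e) ->
  sumnorm (transfer m n - transfer m' n) <= e * (K + 2) ^+ n.
Proof.
move=> e0.
have K0 : 0 <= K by rewrite (le_trans (sumnorm_ge0 _) (AK 0)).
elim: n => [|n IH] Ae /=; first by rewrite expr0 mulr1 subrr sumnorm0.
have -> : A (m + n%:Z) *m transfer m n - A (m' + n%:Z) *m transfer m' n =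
    (A (m + n%:Z) - A (m' + n%:Z)) *m transfer m n
      + A (m' + n%:Z) *m (transfer m n - transfer m' n).
  by rewrite mulmxBl mulmxBr addrA subrK.
apply: le_trans (sumnormD _ _) _.
have -> : e * (K + 2) ^+ n.+1 = e * (2 * (K + 2) ^+ n) + K * (e * (K + 2) ^+ n).
  by rewrite exprS; ring.
apply: lerD; apply: le_trans (sumnormM _ _) _; apply: ler_pM; rewrite ?sumnorm_ge0//.
- exact: Ae.
- exact: transfer_bound.
- by apply: IH => j jn; apply: Ae; rewrite ltnS ltnW.
Qed.

Lemma gordon_lemma (X : int -> 'cV[C]_2) (N : nat -> nat) (d : nat -> R) :
  (forall j, \det (A j) = 1) ->
  (forall j, X (j + 1) = A j *m X j) ->
  (fun n : nat => sumnorm (X n%:Z)) @ \oo --> (0 : R) ->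
  (fun n : nat => sumnorm (X (- n%:Z))) @ \oo --> (0 : R) ->
  N @ \oo --> \oo ->
  (forall k j, (j < N k)%N -> sumnorm (A j%:Z - A (j%:Z + (N k)%:Z)) <= d k) ->
  (forall k j, (j < N k)%N -> sumnorm (A j%:Z - A (j%:Z - (N k)%:Z)) <= d k) ->
  (forall k, 0 <= d k) ->
  (fun k => (K + 2) ^+ N k * d k) @ \oo --> (0 : R) ->
  forall n, X n = 0.
Proof.
move=> detA XA Xp Xm Noo dp dm d0 dN0.
pose x n := sumnorm (X n).
pose bound k := x (N k)%:Z + x (N k + N k)%N%:Z + x (- (N k)%:Z)
  + (K + 2) ^+ N k * d k * (x (N k)%:Z + x 0).
have x_bound k : x 0 <= bound k.
  have tN : transfer 0 (N k) *m X 0 = X (N k)%:Z by rewrite transferP// add0r.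
  (* The three blocks are [0, N), [N, 2 N) and [-N, 0) with N = [N k]; the last one carries X (-N)
     to X 0. *)
  have := @gordon_three_block R (transfer 0 (N k)) (transfer (N k)%:Z (N k))
    (transfer (- (N k)%:Z) (N k)) (X 0) (X (- (N k)%:Z)).
  rewrite tN !transferP// addNr !det_transfer// => /(_ erefl erefl erefl).
  rewrite -PoszD /bound; move/le_trans; apply; rewrite lerD2l mulrDr.
  rewrite [_ * d k]mulrC.
  apply: lerD; apply: ler_wpM2r; rewrite ?sumnorm_ge0// sumnormBC;
    apply: transfer_diff => // j jN; rewrite add0r.
    by rewrite [_ + j%:Z]addrC; exact: dp.
  by rewrite [_ + j%:Z]addrC; exact: dm.
have N2oo : (fun k => N k + N k)%N @ \oo --> \oo.
  move/cvgnyPge: (Noo) => Nge; apply/cvgnyPge => n; near=> k.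
  by rewrite (leq_trans _ (leq_addr _ _))//; near: k; exact: Nge.
have bound0 : bound @ \oo --> (0 : R).
  rewrite (_ : 0 = 0 + 0 + 0 + 0 * (0 + x 0)); last by rewrite mul0r !addr0.
  apply: cvgD; first apply: cvgD; first apply: cvgD.
  - exact: (cvg_comp _ _ Noo Xp).
  - exact: (cvg_comp _ _ N2oo Xp).
  - exact: (cvg_comp _ _ Noo Xm).
  apply: cvgM => //; apply: cvgD; last exact: cvg_cst.
  exact: (cvg_comp _ _ Noo Xp).
have X0 : X 0 = 0.
  apply: sumnorm_eq0; apply/eqP; rewrite eq_le sumnorm_ge0 andbT.
  rewrite -(cvg_lim _ bound0)//; apply: limr_ge; first by apply/cvg_ex; exists 0.
  by near=> k; exact: x_bound.
(* The zero at 0 propagates forward by the recursion, and backward because a transfer matrix of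
   determinant one is inverted by its adjugate. *)
move=> n; have [n0|n0] := leP 0 n.
  by rewrite (_ : n = 0 + `|n|%N%:Z) -?transferP ?X0 ?mulmx0//; lia.
have : transfer n `|n|%N *m X n = 0 by rewrite transferP// -X0; congr X; lia.
move/(congr1 (mulmx (adj2 (transfer n `|n|%N)))).
by rewrite mulmx0 mulmxA mul_adj2 ?det_transfer// mul1mx.
Unshelve. all: by end_near.
Qed.

End Transfer.

(** * Decay of square-summable sequences at infinity *)

Section Ell2Decay.
Variable R : realType.

(** Injectivity makes the series along [h] a subsum, over the range of [h], of the convergent sum
    over all integers. This covers both ends of the line, with h n = n and h n = -n. *)
Lemma summable_comp_cvg0 (f : int -> R) (h : nat -> int) :
  (forall n, 0 <= f n) -> injective h ->
  summable [set: int] (fun n => (f n)%:E) -> f \o h @ \oo --> (0 : R).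
Proof.
move=> f0 hI sf; apply: cvg_series_cvg_0.
have : summable xpredT (fun n => (f (h n))%:E).
  apply: le_lt_trans sf.
  rewrite (_ : (fun _ => _) = [set: nat]); last by apply/seteqP; split.
  rewrite -(@esum_image R nat int setT h (fun n => `|(f n)%:E|%E)); last first.
    by move=> i j _ _ /hI.
  rewrite [leRHS](esumID (range h))// setTI leeDl//.
  exact: esum_ge0.
by move/summable_cvg; apply => n _; rewrite lee_fin.
Qed.

Lemma ell2_cvg0 (psi : ell2 R) (h : nat -> int) : injective h ->
  (fun n => normc (psi (h n))) @ \oo --> (0 : R).
Proof.
move=> hI; have /square_summableP := ell2_valP psi.
move/(summable_comp_cvg0 (fun n => sqr_ge0 _) hI) => cvg2.
rewrite -[0]sqrtr0; under eq_fun do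
  rewrite -[normc _]ger0_norm ?normc_ge0// -sqrtr_sqr.
exact: continuous_cvg (@sqrt_continuous R 0) cvg2.
Qed.

End Ell2Decay.

(** * Szego matrices: determinant, size and Lipschitz dependence on the coefficient *)

Section Szego.
Variable R : realType.
Local Notation C := (R[i]).
Implicit Types a b w : C.

Definition rho a : R := Num.sqrt (1 - normc a ^+ 2).

Lemma rho_gt0 a : normc a < 1 -> 0 < rho a.
Proof. by move=> a1; rewrite sqrtr_gt0 subr_gt0 expr_lt1 ?normc_ge0. Qed.

Lemma sqr_rho a : normc a < 1 -> rho a ^+ 2 = 1 - normc a ^+ 2.
Proof. by move=> /rho_gt0; rewrite sqrtr_gt0 => ?; rewrite sqr_sqrtr ?ltW. Qed.

Lemma sqr_rhoC a : normc a < 1 -> (rho a)%:C ^+ 2 = 1 - conjc a * a.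
Proof. by move=> a1; rewrite conjMc -rmorphXn sqr_rho// rmorphB. Qed.

Lemma rhoC_neq0 a : normc a < 1 -> (rho a)%:C != 0.
Proof. by move=> a1; rewrite (inj_eq (@complexI R)) gt_eqF ?rho_gt0. Qed.

Lemma normc_distD a b : `|normc a - normc b| <= normc (a - b).
Proof.
rewrite ler_norml lerBlDl lerNl opprB lerBlDl; apply/andP; split.
  by rewrite -[normc (a - b)]normc_opp opprB -{1}[b](subrKC a) le_normcD.
by rewrite -{1}[a](subrKC b) le_normcD.
Qed.

(** Rationalising gives (rho b ^ 2 - rho a ^ 2) / (rho a rho b (rho a + rho b)). The three inverse
    factors are each at most [r], and the numerator (|a| + |b|)(|a| - |b|) is at most 2 |a - b| in
    modulus. *)
Lemma inv_rho_dist a b r : normc a < 1 -> normc b < 1 ->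
  (rho a)^-1 <= r -> (rho b)^-1 <= r ->
  `|(rho a)^-1 - (rho b)^-1| <= 2 * r ^+ 3 * normc (a - b).
Proof.
move=> a1 b1 ar br; have a0 := rho_gt0 a1; have b0 := rho_gt0 b1.
have -> : (rho a)^-1 - (rho b)^-1 =
    (rho a)^-1 * (rho b)^-1 * (rho a + rho b)^-1 * (rho b ^+ 2 - rho a ^+ 2).
  by field; rewrite !gt_eqF ?addr_gt0.
rewrite !sqr_rho// (_ : _ - _ = (normc a + normc b) * (normc a - normc b)); last by ring.
have sum_le2 : normc a + normc b <= 2 by rewrite (_ : 2 = 1 + 1)// lerD ?ltW.
have ia : 0 <= (rho a)^-1 by rewrite invr_ge0 ltW.
have ib : 0 <= (rho b)^-1 by rewrite invr_ge0 ltW.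
have iab : 0 <= (rho a + rho b)^-1 by rewrite invr_ge0 addr_ge0 ?ltW.
have nab : 0 <= normc a + normc b by rewrite addr_ge0 ?normc_ge0.
rewrite mulrA normrM ger0_norm ?mulr_ge0//.
have inv_sum : (rho a + rho b)^-1 <= r.
  by rewrite (le_trans _ ar)// lef_pV2 ?posrE ?addr_gt0// lerDl ltW.
rewrite (_ : 2 * r ^+ 3 = r * r * r * 2); last by ring.
by do ![apply: ler_pM]; rewrite ?normc_distD ?mulr_ge0 ?normr_ge0.
Qed.

Definition szego w a : 'M[C]_2 := ((rho a)^-1)%:C *:
  \matrix_(i, j) if i == 0 then if j == 0 then w^-1 else - a
                 else if j == 0 then - conjc a else w.

Lemma det_szego w a : w != 0 -> normc a < 1 -> \det (szego w a) = 1.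
Proof.
move=> w0 a1; rewrite det2 !mxE /=.
rewrite (_ : _ - _ = ((rho a)^-1)%:C ^+ 2 * (1 - conjc a * a)); last first.
  by field; rewrite w0 andbT rhoC_neq0.
by rewrite -sqr_rhoC// -exprMn -rmorphM mulVf ?expr1n// gt_eqF ?rho_gt0.
Qed.

Lemma sumnorm_szego w a r : normc a < 1 -> (rho a)^-1 <= r ->
  sumnorm (szego w a) <= r * (normc w^-1 + normc w + 2).
Proof.
move=> a1 ar; have a0 := rho_gt0 a1.
rewrite sumnormZ normc_real ?invr_ge0 ?(ltW a0)//.
apply: ler_pM; rewrite ?invr_ge0 ?sumnorm_ge0 ?(ltW a0)//.
rewrite sumnorm2 !mxE /= !normc_opp normc_conj; move: a1.
move: (normc a) (normc w) (normc w^-1) => x y z; lra.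
Qed.

(** The first summand of the constant pays for the change of the scalar prefactor, the second for
    the two off-diagonal entries, each of which moves by |a - b|. *)
Lemma sumnorm_szegoB w a b r : normc a < 1 -> normc b < 1 ->
  (rho a)^-1 <= r -> (rho b)^-1 <= r ->
  sumnorm (szego w a - szego w b) <=
    (2 * r ^+ 3 * (normc w^-1 + normc w + 2) + 2 * r) * normc (a - b).
Proof.
move=> a1 b1 ar br; have b0 := rho_gt0 b1.
rewrite /szego; set Qa := \matrix_(i, j) _; set Qb := \matrix_(i, j) _.
have -> : ((rho a)^-1)%:C *: Qa - ((rho b)^-1)%:C *: Qb =
    ((rho a)^-1 - (rho b)^-1)%:C *: Qa + ((rho b)^-1)%:C *: (Qa - Qb).
  by rewrite rmorphB scalerBl scalerBr addrA subrK.
apply: le_trans (sumnormD _ _) _; rewrite !sumnormZ mulrDl; apply: lerD.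
  rewrite mulrAC; apply: ler_pM; rewrite ?normc_ge0 ?sumnorm_ge0//.
    by rewrite /= expr0n addr0 sqrtr_sqr inv_rho_dist.
  rewrite sumnorm2 !mxE /= !normc_opp normc_conj; move: a1.
  move: (normc a) (normc w) (normc w^-1) => x y z; lra.
rewrite normc_real ?invr_ge0 ?(ltW b0)// [2 * r]mulrC -mulrA.
apply: ler_pM; rewrite ?invr_ge0 ?sumnorm_ge0 ?(ltW b0)//.
rewrite sumnorm2 !mxE /= !subrr Normc.normc0 -!opprD !normc_opp.
rewrite -[conjc a - _]rmorphB normc_conj; lra.
Qed.

End Szego.

(** A Theta block sends (y, y') to (x, x'). Solving instead for the right-hand values (x', y') in
    terms of the left-hand ones (x, y) turns the block into a step from site n to n + 1. Here [b]
    stands for the conjugate of [a], and [p] for rho. *)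
Lemma theta_solve (F : fieldType) (a b p x x' y y' : F) :
  p != 0 -> p ^+ 2 = 1 - b * a ->
  x = b * y + p * y' -> x' = p * y - a * y' ->
  y' = p^-1 * (x - b * y) /\ x' = p^-1 * (y - a * x).
Proof.
move=> p0 p2 -> ->; split; first by rewrite addrC addKr mulKf.
apply: (mulfI p0); rewrite mulVKf// mulrBr mulrA -expr2 p2; ring.
Qed.

(** * From the eigenvalue equation to the Szego recursion *)

Section Equation.
Variable R : realType.
Local Notation C := (R[i]).
Implicit Types (alpha : int -> disk R) (psi : ell2 R).

Lemma Theta_sum_fst alpha s psi (n j : int) : n = 2 * j + s ->
  Theta_sum alpha s psi n =
    conjc (alpha n) * psi n + (rho (alpha n))%:C * psi (n + 1).
Proof.
move=> nE; rewrite /= /dsum2_fun sum_ord2 /=.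
have -> : ((n - s) %/ 2)%Z = j by lia.
have -> : ((n - s) %% 2)%Z = 0 by lia.
rewrite -nE addr0 (_ : inord _ = 0) /Theta ?mxE//.
by apply: val_inj; rewrite /= inordK.
Qed.

Lemma Theta_sum_snd alpha s psi (n j : int) : n = 2 * j + s ->
  Theta_sum alpha s psi (n + 1) =
    (rho (alpha n))%:C * psi n - (alpha n : C) * psi (n + 1).
Proof.
move=> nE; rewrite /= /dsum2_fun sum_ord2 /=.
have -> : ((n + 1 - s) %/ 2)%Z = j by lia.
have -> : ((n + 1 - s) %% 2)%Z = 1 by lia.
rewrite -nE addr0 (_ : inord _ = 1) /Theta ?mxE ?mulNr//.
by apply: val_inj; rewrite /= inordK.
Qed.

Lemma Theta_sum_inj alpha s psi : Theta_sum alpha s psi = 0 -> psi = 0.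
Proof.
move=> T0; apply: val_inj; apply/funext => n /=; rewrite -[RHS]/(0 : C).
have pair0 m j : m = 2 * j + s -> psi m = 0 :> C /\ psi (m + 1) = 0 :> C.
  move=> mE; have a1 := disk_valP (alpha m); have p0 := rhoC_neq0 a1.
  have := Theta_sum_fst alpha psi mE; have := Theta_sum_snd alpha psi mE.
  rewrite T0 -![val 0 _]/(0 : C) => E1 E2.
  (* With both outputs zero, the formula for x' forces y = 0, and then the one for y' gives y' =
     0. *)
  have [] := theta_solve p0 (sqr_rhoC a1) E2 E1.
  rewrite mulr0 subr0 sub0r => y' /esym/eqP.
  rewrite mulf_eq0 invr_eq0 (negbTE p0) /= => /eqP y.
  by rewrite y y' y mulr0 oppr0 mulr0.
have [j [nE|nE]] : exists j : int, n = 2 * j + s \/ n - 1 = 2 * j + s.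
  by exists ((n - s) %/ 2)%Z; lia.
  by have [] := pair0 _ _ nE.
by have [_] := pair0 _ _ nE; rewrite subrK.
Qed.

(* Swapping the two coordinates at alternate sites and rescaling one of them by
   a square root w of the spectral parameter z gives the same one-step matrix
   at even and odd sites, so that periods of either parity can be used. *)
Definition szego_state (w : C) (u v : int -> C) (n : int) : 'cV[C]_2 :=
  \col_i if (i == 0) == (2 %| n)%Z then v n else w * u n.

(** For even n the sites n, n + 1 form a block of L, with input v = M psi and output w^2 psi; for
    odd n they form a block of M, with input psi and output v. Each case is one use of
    [theta_solve]. *)
Lemma szego_stateP alpha w psi n : w != 0 ->
  extended_CMV alpha psi = w ^+ 2 *: psi ->
  let X := szego_state w psi (Theta_sum alpha 1 psi) in
  X (n + 1) = szego w (alpha n) *m X n.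
Proof.
move=> w0 eig X; rewrite {}/X.
have a1 := disk_valP (alpha n); have p0 := rhoC_neq0 a1.
have pV : ((rho (alpha n))^-1)%:C = ((rho (alpha n))%:C)^-1.
  by rewrite rmorphV ?unitfE ?gt_eqF ?rho_gt0.
have eigE m : Theta_sum alpha 0 (Theta_sum alpha 1 psi) m = w ^+ 2 * psi m :> C.
  by rewrite -[LHS]/(extended_CMV alpha psi m) eig.
have p2 := sqr_rhoC a1; have [n2|n2] := boolP (2 %| n)%Z.
  have nE : n = 2 * (n %/ 2)%Z + 0 by lia.
  have := Theta_sum_snd alpha (Theta_sum alpha 1 psi) nE.
  have := Theta_sum_fst alpha (Theta_sum alpha 1 psi) nE.
  rewrite !eigE; move: (Theta_sum alpha 1 psi) => v E1 E2.
  have [v' u'] := theta_solve p0 p2 E1 E2.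
  (* The block of L yields w^2 psi (n + 1), while the state holds w psi (n + 1). *)
  have wu' : w * psi (n + 1) = w^-1 * (w ^+ 2 * psi (n + 1)) :> C by field.
  have n1 : (2 %| n + 1)%Z = false by lia.
  apply/matrixP => i k; rewrite [k]ord1 !mxE sum_ord2 !mxE n1 n2 {k}.
  by elim/ord2_ind: i; rewrite /= ?wu' ?u' ?v' pV; field; rewrite p0.
have nE : n = 2 * (n %/ 2)%Z + 1 by lia.
have := Theta_sum_snd alpha psi nE; have := Theta_sum_fst alpha psi nE.
move: (Theta_sum alpha 1 psi) => v E1 E2.
have [u' v'] := theta_solve p0 p2 E1 E2.
have n1 : (2 %| n + 1)%Z by lia.
apply/matrixP => i k; rewrite [k]ord1 !mxE sum_ord2 !mxE n1 (negbTE n2) {k}.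
by elim/ord2_ind: i; rewrite /= ?u' ?v' pV; field; rewrite p0 ?w0.
Qed.

Lemma szego_state_cvg0 w (u v : ell2 R) (h : nat -> int) : injective h ->
  (fun n => sumnorm (szego_state w u v (h n))) @ \oo --> (0 : R).
Proof.
move=> hI; rewrite (_ : (fun n => _) =
    (fun n => normc (v (h n)) + normc w * normc (u (h n))))%R; last first.
  apply/funext => n; rewrite sumnorm_col2 !mxE /=.
  by case: (_ %| _)%Z; rewrite /= Normc.normcM // addrC.
rewrite -[0](addr0) -[X in _ + X](mulr0 (normc w)).
by apply: cvgD; [|apply: cvgM; first exact: cvg_cst]; exact: ell2_cvg0.
Qed.

Lemma extended_CMV_inj alpha psi : extended_CMV alpha psi = 0 -> psi = 0.
Proof. by move=> /Theta_sum_inj/Theta_sum_inj. Qed.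

End Equation.

(** * Gordon sequences: uniform constants and vanishing of the eigenvector *)

Theorem theorem1p5 (R : realType) (alpha : int -> disk R) :
  Gordon_sequence alpha -> purely_continuous_spectrum (extended_CMV alpha).
Proof.
move=> [sup_lt1 [N [_ Noo gordon]]] z [psi [psi0 eig]].
have [z0|z0] := eqVneq z 0.
  move/negP: psi0; apply; apply/eqP/(@extended_CMV_inj _ alpha).
  by rewrite eig z0 scale0r.
have [w w2] : exists w : R[i], w ^+ 2 = z by exists (sqrtc z); exact: sqr_sqrtc.
have w0 : w != 0 by apply: contraNneq z0 => w0; rewrite -w2 w0 expr0n.
rewrite -{z z0}w2 in eig.
have [s s1 alpha_s] : exists2 s : R, s < 1 & forall n, normc (alpha n) <= s.
  have ub n : ((normc (alpha n))%:E <=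
      ereal_sup (range (fun n => (normc (alpha n))%:E)))%E.
    by apply: ereal_sup_ubound; exists n.
  move: (ereal_sup _) ub sup_lt1 => [s| |] ub //; last by have := ub 0.
  by rewrite lte_fin => s1; exists s => // n; rewrite -lee_fin.
have s0 : 0 <= s := le_trans (normc_ge0 _) (alpha_s 0).
(* Being bounded away from the unit circle makes 1 / rho bounded by [r]; [K] and [L] below are the
   resulting size and Lipschitz constants of the Szego matrices, uniform in n. *)
pose r := (Num.sqrt (1 - s ^+ 2))^-1.
have alpha1 n := disk_valP (alpha n).
have rho_r n : (rho (alpha n))^-1 <= r.
  rewrite lef_pV2 ?posrE ?rho_gt0 ?sqrtr_gt0 ?subr_gt0 ?expr_lt1//.
  by rewrite ler_wsqrtr// lerD2l lerN2 ler_sqr ?nnegrE ?normc_ge0.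
have r0 : 0 <= r by rewrite invr_ge0 sqrtr_ge0.
pose S := normc w^-1 + normc w + 2; pose K := r * S.
pose L := 2 * r ^+ 3 * S + 2 * r.
have S0 : 0 <= S by rewrite !addr_ge0 ?normc_ge0.
have L0 : 0 <= L by rewrite addr_ge0 ?mulr_ge0 ?exprn_ge0.
pose M e k := \big[Num.max/0]_(j < N k)
  normc ((alpha j%:Z : R[i]) - (alpha (j%:Z + e * (N k)%:Z) : R[i])).
have M0 e k : 0 <= M e k by exact: bigmax_ge_id.
have MP e k j : (j < N k)%N ->
    sumnorm (szego w (alpha j%:Z) - szego w (alpha (j%:Z + e * (N k)%:Z))) <= L * M e k.
  move=> jN.
  apply: le_trans (sumnorm_szegoB _ (alpha1 _) (alpha1 _) (rho_r _) (rho_r _)) _.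
  rewrite ler_wpM2l//.
  exact: (le_bigmax _ (fun j : 'I_(N k) => normc ((alpha j%:Z : R[i]) -
    (alpha (j%:Z + e * (N k)%:Z) : R[i]))) (Ordinal jN)).
have KP n : sumnorm (szego w (alpha n)) <= K by exact: sumnorm_szego.
have X0 : forall n, szego_state w psi (Theta_sum alpha 1 psi) n = 0.
  (* Summing the errors of the two signs gives one sequence that dominates both. The Gordon
     condition is then used with constant [K + 2]. *)
  apply: (@gordon_lemma R (fun n => szego w (alpha n)) K KP _ N
    (fun k => L * (M 1 k + M (-1) k))) => //.
  - by move=> n; exact: det_szego.
  - by move=> n; exact: szego_stateP.
  - by apply: szego_state_cvg0 => i j [].
  - by apply: szego_state_cvg0 => i j /oppr_inj [].
  - move=> k j /(MP 1); rewrite mul1r => /le_trans; apply.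
    by rewrite ler_wpM2l// lerDl.
  - move=> k j /(MP (-1)); rewrite mulN1r => /le_trans; apply.
    by rewrite ler_wpM2l// lerDr.
  - by move=> k; apply: mulr_ge0 => //; apply: addr_ge0; exact: M0.
  - have K2 : 0 < K + 2 by rewrite ltr_wpDl ?mulr_ge0.
    have g1 := gordon 1 (or_introl erefl) _ K2.
    have g2 := gordon (-1) (or_intror erefl) _ K2.
    rewrite (_ : (fun k => _) = (fun k => L * ((K + 2) ^+ N k * M 1 k
        + (K + 2) ^+ N k * M (-1) k))); last by apply/funext => k; ring.
    rewrite -(mulr0 L) -[X in _ * X]addr0.
    by apply: cvgM; [exact: cvg_cst | exact: cvgD].
move/eqP: psi0; apply; apply: val_inj; apply/funext => n; rewrite -[RHS]/(0 : R[i]).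
apply: (mulfI w0); rewrite mulr0.
(* The entry w psi n of the state sits in row 1 for even n and in row 0 for odd n. *)
have /matrixP/(_ (if (2 %| n)%Z then 1 else 0) 0) := X0 n.
by rewrite !mxE; case: (2 %| n)%Z.
Qed.
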